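(* Let $\Bbbk$ be an infinite field, $R=\Bbbk[x_0,\dots,x_n]$, and let $I\subset R$ be a homogeneous ideal. Let $d$ be an integer. For a general linear form $L\in[R]_1$ assume that $$\times L:[R/I]_d\to[R/I]_{d+1}$$ is injective (i.e. $h_d-h_{d+1}+\ell_{d+1}=0$), and that $$\times L:[R/I]_{d-1}\to[R/I]_d$$ has an $s$-dimensional kernel (i.e. $h_{d-1}-h_d+\ell_d=s$). Then $R/I$ has an $s$-dimensional socle in degree $d-1$.
   Context: $[M]_i$ denotes the degree $i$ component of a graded module $M$, $h_i=\dim_\Bbbk[R/I]_i$ and $\ell_i=\dim_\Bbbk[R/(I,L)]_i$. The socle of $R/I$ in degree $i$ is the subspace of elements of $[R/I]_i$ annihilated by all linear forms of $R$. ''For a general linear form'' means for all $L$ in a nonempty Zariski-open subset of $[R]_1$. *)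

(* Defs.v *)
From HB Require Import structures.
From mathcomp Require Import all_boot all_algebra.
From mathcomp Require Import boolp classical_sets functions cardinality.
From mathcomp Require Import mpoly.

Set Implicit Arguments.
Unset Strict Implicit.
Unset Printing Implicit Defensive.

Import GRing.Theory.

Local Open Scope classical_set_scope.
Local Open Scope quotient_scope.
Local Open Scope ring_scope.

(* MathComp's [idealr] requires a proper ideal; here the unit ideal is allowed,
   so the quotient is only a [comPzRingType]. *)
Record ideal (R : comNzRingType) := Ideal {
  ideal_set :> R -> Prop;
  ideal0 : ideal_set 0;
  idealD : forall x y, ideal_set x -> ideal_set y -> ideal_set (x + y);
  idealMl : forall a x, ideal_set x -> ideal_set (a * x)
}.

Section RingQuotient.
Variables (R : comNzRingType) (I : ideal R).

Definition ideal_pred : {pred R} := fun x => `[< I x >].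

Lemma ideal_predE x : (x \in ideal_pred) = `[< I x >].
Proof. by []. Qed.

Lemma ideal_pred_zmod : zmod_closed ideal_pred.
Proof.
split=> [|x y]; rewrite !ideal_predE; first exact/asboolP/ideal0.
move=> /asboolP Ix /asboolP Iy; apply/asboolP/idealD => //.
by rewrite -mulN1r; apply: idealMl.
Qed.

Definition ideal_zmod : zmodClosed R :=
  HB.pack ideal_pred (GRing.isZmodClosed.Build R ideal_pred ideal_pred_zmod).

Definition rquot := Quotient.quot ideal_zmod.

HB.instance Definition _ := GRing.Zmodule.on rquot.

Definition rquot_class (x : R) : rquot := \pi_rquot x.

Lemma rquot_classP x y : rquot_class x = rquot_class y <-> I (x - y).
Proof.
split=> [/eqP|Ixy].
  by rewrite /rquot_class -Quotient.idealrBE ideal_predE => /asboolP.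
by apply/eqP; rewrite /rquot_class -Quotient.idealrBE ideal_predE; apply/asboolP.
Qed.

Lemma rquot_classK x : rquot_class (repr x) = x.
Proof. exact: reprK. Qed.

Lemma rquot_classD x y : rquot_class (x + y) = rquot_class x + rquot_class y.
Proof. exact: Quotient.pi_add. Qed.

Definition rquot_one : rquot := rquot_class 1.
Definition rquot_mul (x y : rquot) : rquot := rquot_class (repr x * repr y).

Lemma rquot_classM x y :
  rquot_class (x * y) = rquot_mul (rquot_class x) (rquot_class y).
Proof.
apply/rquot_classP; set x' := repr _; set y' := repr _.
have Ix : I (x - x') by apply/rquot_classP; rewrite rquot_classK.
have Iy : I (y - y') by apply/rquot_classP; rewrite rquot_classK.
have -> : x * y - x' * y' = y * (x - x') + x' * (y - y').
  by rewrite !mulrBr mulrC [y * x']mulrC addrA subrK.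
by apply: idealD; apply: idealMl.
Qed.

Lemma rquot_mulA : associative rquot_mul.
Proof.
move=> x y z; rewrite -[x]rquot_classK -[y]rquot_classK -[z]rquot_classK.
by rewrite -!rquot_classM mulrA.
Qed.

Lemma rquot_mulC : commutative rquot_mul.
Proof.
move=> x y; rewrite -[x]rquot_classK -[y]rquot_classK.
by rewrite -!rquot_classM mulrC.
Qed.

Lemma rquot_mul1 : left_id rquot_one rquot_mul.
Proof. by move=> x; rewrite -[x]rquot_classK -rquot_classM mul1r. Qed.

Lemma rquot_mulDl : left_distributive rquot_mul +%R.
Proof.
move=> x y z; rewrite -[x]rquot_classK -[y]rquot_classK -[z]rquot_classK.
by rewrite -rquot_classD -!rquot_classM -rquot_classD mulrDl.
Qed.

HB.instance Definition _ := GRing.Zmodule_isComPzRing.Build rquot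
  rquot_mulA rquot_mulC rquot_mul1 rquot_mulDl.

End RingQuotient.

Section MpolyQuotient.
Variables (k : fieldType) (n : nat) (I : ideal {mpoly k[n]}).

(* The vector space structure on the quotient: restriction of scalars along
   the inclusion of the constants [c%:MP]. *)
Definition rquot_scale (c : k) (x : rquot I) : rquot I := rquot_class I c%:MP * x.

Lemma rquot_classMr p q :
  rquot_class I (p * q) = rquot_class I p * rquot_class I q.
Proof. exact: rquot_classM. Qed.

Lemma rquot_scaleA a b x :
  rquot_scale a (rquot_scale b x) = rquot_scale (a * b) x.
Proof. by rewrite /rquot_scale mulrA -rquot_classMr mpolyCM. Qed.

Lemma rquot_scale1 : left_id 1 rquot_scale.
Proof. by move=> x; rewrite /rquot_scale mpolyC1 (mul1r x). Qed.

Lemma rquot_scaleDr : right_distributive rquot_scale +%R.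
Proof. by move=> c x y; rewrite /rquot_scale mulrDr. Qed.

Lemma rquot_scaleDl x : {morph rquot_scale^~ x : a b / a + b}.
Proof.
by move=> a b; rewrite /rquot_scale mpolyCD rquot_classD mulrDl.
Qed.

HB.instance Definition _ := GRing.Zmodule_isLmodule.Build k (rquot I)
  rquot_scaleA rquot_scale1 rquot_scaleDr rquot_scaleDl.

Definition homogeneous_ideal :=
  forall p, I p -> forall i : nat, I (pihomog mdeg i p).

Definition homog_component (i : int) : set {mpoly k[n]} :=
  match i with
  | Posz m => [set p | p \is m.-homog]
  | Negz _ => [set 0]
  end.

Definition quot_component (i : int) : set (rquot I) :=
  rquot_class I @` homog_component i.

Definition mul_by (L : {mpoly k[n]}) (x : rquot I) : rquot I :=
  rquot_class I L * x.

Lemma mul_by_component (i : int) (L : {mpoly k[n]}) :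
  homog_component 1 L ->
  set_fun (quot_component i) (quot_component (i + 1)) (mul_by L).
Proof.
move=> L1 _ [p hp <-]; rewrite /mul_by -rquot_classMr.
exists (L * p) => //; case: i hp => [m|m] /= hp.
  by rewrite addn1 -add1n; apply: dhomogM.
by rewrite hp mulr0; case: m {hp} => [|m] //=; apply: dhomog0.
Qed.

Definition mul_ker (L : {mpoly k[n]}) (i : int) : set (rquot I) :=
  [set x | quot_component i x /\ mul_by L x = 0].

Definition socle (i : int) : set (rquot I) :=
  [set x | quot_component i x /\
           forall L, homog_component 1 L -> mul_by L x = 0].

End MpolyQuotient.

Arguments quot_component [k n] I i.
Arguments mul_by [k n] I L.
Arguments mul_ker [k n] I L i.
Arguments socle [k n] I i.

Definition has_dim (k : fieldType) (V : lmodType k) (W : set V) (s : nat) :=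
  exists b : 'I_s -> V,
    (forall c : 'I_s -> k, \sum_(j < s) c j *: b j = 0 -> forall j, c j = 0) /\
    W = [set \sum_(j < s) c j *: b j | c in [set: 'I_s -> k]].

Section GeneralLinearForm.
Variables (k : fieldType) (n : nat).

(* The Zariski topology on the space of linear forms is that of the affine
   space of coefficient vectors: a closed set is the zero locus of a set [F] of
   polynomials in the coefficients. *)
Definition zariski_open (U : set {mpoly k[n]}) :=
  exists F : set {mpoly k[n]},
    U = [set L | homog_component 1 L /\
                 exists2 f, F f & f.@[fun i : 'I_n => L@_U_(i)] != 0].

Definition for_general_linear_form (P : {mpoly k[n]} -> Prop) :=
  exists U, [/\ zariski_open U, U !=set0 & forall L, U L -> P L].

End GeneralLinearForm.

(* Main.v *)
Require Import Defs.
From mathcomp Require Import all_boot all_algebra.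
From mathcomp Require Import boolp classical_sets functions cardinality.
From mathcomp Require Import mpoly.

Import GRing.Theory.

Local Open Scope ring_scope.

(** Multiplications by linear forms commute. Hence, if [L x = 0] with [x] in
    degree [i], then every linear form [M] satisfies [L (M x) = M (L x) = 0];
    as [M x] lies in degree [i + 1], where [L] acts injectively, [M x = 0].
    So the kernel of a single such [L] in degree [i] is already the whole socle
    in that degree ([mul_ker_socle]), and any [L] in the open set provided by
    the genericity hypothesis yields the dimension for [i = d - 1]. *)

Lemma mul_by0 (k : fieldType) (n : nat) (I : ideal {mpoly k[n]})
    (L : {mpoly k[n]}) :
  mul_by I L 0 = 0.
Proof. exact: mulr0. Qed.

Lemma mul_byCA (k : fieldType) (n : nat) (I : ideal {mpoly k[n]})
    (L M : {mpoly k[n]}) (x : rquot I) :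
  mul_by I L (mul_by I M x) = mul_by I M (mul_by I L x).
Proof. exact: mulrCA. Qed.

Lemma quot_component0 (k : fieldType) (n : nat) (I : ideal {mpoly k[n]})
    (i : int) :
  quot_component I i 0.
Proof.
exists 0; first by case: i => [m|m] //=; apply: dhomog0.
by apply: (@addrI _ (rquot_class I 0)); rewrite -rquot_classD !addr0.
Qed.

Lemma mul_ker_socle (k : fieldType) (n : nat) (I : ideal {mpoly k[n]})
    (L : {mpoly k[n]}) (i : int) :
  homog_component 1 L ->
  set_inj (quot_component I (i + 1)) (mul_by I L) ->
  mul_ker I L i = socle I i.
Proof.
move=> L1 injL; apply/seteqP; split=> x [xi]; last first.
  by move=> sx; split=> //; apply: sx.
move=> Lx0; split=> // M M1.
apply: injL; rewrite ?inE.
- exact: mul_by_component.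
- exact: quot_component0.
- by rewrite mul_byCA Lx0 !mul_by0.
Qed.

Theorem lemma3p12 (k : fieldType) (n : nat) (I : ideal {mpoly k[n.+1]})
    (d : int) (s : nat) :
  infinite_set [set: k]%classic ->
  homogeneous_ideal I ->
  for_general_linear_form (fun L =>
    set_inj (quot_component I d) (mul_by I L) /\
    has_dim (mul_ker I L (d - 1)) s) ->
  has_dim (socle I (d - 1)) s.
Proof.
move=> _ _ [U [[F UE] [L UL] genP]].
have [injL dimL] := genP L UL.
have L1 : homog_component 1 L by move: UL; rewrite UE => -[].
by rewrite -(@mul_ker_socle _ _ _ L) // subrK.
Qed.
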